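(* Let $u_L:[m]\times[n]\to[-1,1]$ be a learner payoff satisfying the standing assumptions. For any consistent no-regret learning algorithm $\mathcal{A}$ (with respect to $u_L$), $\mathcal{M}_{NSR}\subseteq\mathcal{M}(\mathcal{A})$.
   Context: The optimizer has action set $[m]$ and the learner has action set $[n]$. $\Delta_k$ is the simplex over $[k]$; $\Delta_{mn}$ is the set of probability distributions over $[m]\times[n]$, whose elements are called correlated strategy profiles (CSPs). $x\otimes y$ is the product distribution. $u_L$ is extended (multi)linearly to $\Delta_m\times\Delta_n$ and to $\Delta_{mn}$. $\mathrm{BR}_L(x)=\arg\max_{j\in[n]}u_L(x,j)$. Standing assumptions on $u_L$: (1) there is a unique pair $(i^*,j^* )\in[m]\times[n]$ maximizing $u_L$; (2) the learner has no weakly dominated action, i.e. every $j\in[n]$ for which some $x\in\Delta_m$ has $j\in\mathrm{BR}_L(x)$ also admits some $x'\in\Delta_m$ with $\mathrm{BR}_L(x')=\{j\}$. A learning algorithm $\mathcal{A}=\{A^T\}_{T\in\mathbb{N}}$ consists, for each horizon $T$, of functions $A^T_t:\Delta_m^{t-1}\to\Delta_n$, $t=1,\dots,T$; against $(x_1,\dots,x_T)\in\Delta_m^T$ the learner plays $y_t=A^T_t(x_1,\dots,x_{t-1})$. The menu $\mathcal{M}(A^T)$ is the convex hull of all points $\frac1T\sum_{t=1}^T x_t\otimes y_t$ over all optimizer sequences. $\mathcal{A}$ is consistent if $\mathcal{M}(A^1),\mathcal{M}(A^2),\dots$ converges in the Hausdorff metric; the (closed) limit $\mathcal{M}(\mathcal{A})$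 is its asymptotic menu. $\mathcal{A}$ is no-regret if there is a function $o(T)$ such that for every $T$ and every optimizer sequence, $\sum_{t=1}^T u_L(x_t,y_t)\ge\max_{j\in[n]}\sum_{t=1}^T u_L(x_t,j)-o(T)$. $\mathcal{M}_{NSR}$ is the convex hull of all no-swap-regret CSPs, i.e. CSPs $\varphi$ with $\sum_{i}\varphi_{ij}u_L(i,j)\ge\max_{j'\in[n]}\sum_{i}\varphi_{ij}u_L(i,j')$ for each $j\in[n]$. *)

(* Defs.v *)
From HB Require Import structures.
From mathcomp Require Import all_boot all_order all_algebra.
From mathcomp Require Import all_classical all_reals all_analysis.
Set Implicit Arguments.
Unset Strict Implicit.
Unset Printing Implicit Defensive.
Import Order.TTheory GRing.Theory Num.Theory.
Import numFieldNormedType.Exports.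
Local Open Scope classical_set_scope.
Local Open Scope ring_scope.

Definition simplex (R : realType) (k : nat) : set 'rV[R]_k :=
  [set x | (forall i, 0 <= x ord0 i) /\ \sum_(i < k) x ord0 i = 1].
Arguments simplex : clear implicits.

Section Geometry.
Context {R : realType}.

Definition convex_hull (V : lmodType R) (A : set V) : set V :=
  [set p | exists (k : nat) (w : simplex R k) (s : 'I_k -> V),
     (forall i, A (s i)) /\ p = \sum_(i < k) val w ord0 i *: s i].

(* It is +oo when exactly one of the sets is empty or when the sets are not at
   bounded distance, and -oo when both are empty. *)
Definition hausdorff_dist (X : pseudoMetricType R) (A B : set X) : \bar R :=
  maxe (ereal_sup [set edist_inf B a | a in A])
       (ereal_sup [set edist_inf A b | b in B]).

End Geometry.

Section Game.
Context {R : realType} {m n : nat}.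

(* Correlated strategy profiles: Delta_{mn}, as m x n matrices. *)
Definition csp : set 'M[R]_(m, n) :=
  [set phi | (forall i j, 0 <= phi i j) /\
             \sum_(i < m) \sum_(j < n) phi i j = 1].

Definition product_csp (x : 'rV[R]_m) (y : 'rV[R]_n) : 'M[R]_(m, n) :=
  \matrix_(i, j) (x ord0 i * y ord0 j).

Variable uL : 'I_m -> 'I_n -> R.

(* uL extended linearly to CSPs, to mixed profiles (x, y), and to profiles
   (x, j) where the learner plays a pure action. *)
Definition payoff_csp (phi : 'M[R]_(m, n)) : R :=
  \sum_(i < m) \sum_(j < n) phi i j * uL i j.

Definition payoff (x : 'rV[R]_m) (y : 'rV[R]_n) : R :=
  payoff_csp (product_csp x y).

Definition payoff_pure (x : 'rV[R]_m) (j : 'I_n) : R :=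
  \sum_(i < m) x ord0 i * uL i j.

Definition BR (x : 'rV[R]_m) : set 'I_n :=
  [set j | forall j', payoff_pure x j' <= payoff_pure x j].

Definition unique_maximizer : Prop :=
  exists! p : 'I_m * 'I_n, forall i j, uL i j <= uL p.1 p.2.

Definition no_weakly_dominated_action : Prop :=
  forall j : 'I_n,
    (exists x : simplex R m, BR (val x) j) ->
    exists x' : simplex R m, BR (val x') = [set j].

Definition no_swap_regret_csp : set 'M[R]_(m, n) :=
  [set phi | csp phi /\
     forall j j' : 'I_n,
       \sum_(i < m) phi i j * uL i j' <= \sum_(i < m) phi i j * uL i j].

Definition M_NSR : set 'M[R]_(m, n) := convex_hull no_swap_regret_csp.

(* [A T t] is the function used at horizon [T] in round [t]; rounds are
   numbered from 0, so its argument is the sequence of the [t] optimizer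
   strategies already played. *)
Definition learning_algorithm : Type :=
  forall (T : nat) (t : 'I_T), ('I_t -> simplex R m) -> simplex R n.

Definition history (T : nat) (x : 'I_T -> simplex R m) (t : 'I_T) :
    'I_t -> simplex R m :=
  fun s => x (widen_ord (ltnW (ltn_ord t)) s).
Arguments history {T} x t.

Definition response (A : learning_algorithm) (T : nat)
    (x : 'I_T -> simplex R m) (t : 'I_T) : simplex R n :=
  A T t (history x t).

Definition average_csp (A : learning_algorithm) (T : nat)
    (x : 'I_T -> simplex R m) : 'M[R]_(m, n) :=
  T%:R^-1 *: \sum_(t < T) product_csp (val (x t)) (val (response A x t)).

Definition menu (A : learning_algorithm) (T : nat) : set 'M[R]_(m, n) :=
  convex_hull (range (@average_csp A T)).

Definition is_asymptotic_menu (A : learning_algorithm)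
    (M : set 'M[R]_(m, n)) : Prop :=
  closed M /\ hausdorff_dist (menu A T) M @[T --> \oo] --> 0%E.

Definition consistent (A : learning_algorithm) : Prop :=
  exists M, is_asymptotic_menu A M.

(* The limit menu; meaningful when [A] is consistent, in which case it is the
   only set satisfying [is_asymptotic_menu A]. *)
Definition asymptotic_menu (A : learning_algorithm) : set 'M[R]_(m, n) :=
  xget set0 (is_asymptotic_menu A).

Definition no_regret (A : learning_algorithm) : Prop :=
  exists f : nat -> R,
    f =o_\oo (fun T : nat => T%:R : R) /\
    forall (T : nat) (x : 'I_T -> simplex R m) (j : 'I_n),
      \sum_(t < T) payoff_pure (val (x t)) j - f T <=
      \sum_(t < T) payoff (val (x t)) (val (response A x t)).

End Game.

Arguments learning_algorithm : clear implicits.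

(* Main.v *)
(* A no-swap-regret CSP phi splits, along the learner's action j, as the convex
   combination sum_j l_j (x_j (x) e_j), where j is a best response to x_j
   whenever l_j > 0.  As no action is weakly dominated, x_j can be moved
   slightly so that j becomes the unique best response, with a payoff gap.
   Against an optimizer that plays x_j in every round, a no-regret learner then
   plays j in all but o(T) rounds, so x_j (x) e_j is a limit of average CSPs.
   Since menus are convex hulls, the l_j-combination of these averages lies in
   the menu at horizon T, and closedness of the limit gives phi. *)
Require Import Defs.
From mathcomp Require Import all_boot all_order all_algebra.
From mathcomp Require Import all_classical all_reals all_analysis.
From mathcomp Require Import ring lra.
Set Implicit Arguments.
Unset Strict Implicit.
Import Order.TTheory GRing.Theory Num.Theory.
Import numFieldNormedType.Exports.
Local Open Scope classical_set_scope.
Local Open Scope ring_scope.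

(** For large T the point of [S T] near p lies within e / 2 of some point of [M], so the triangle
    inequality puts points of [M] in every ball around p. *)
Lemma closed_hausdorff_lim (R : realType) (X : pseudoMetricType R)
    (S : nat -> set X) (M : set X) (p : X) :
  closed M -> hausdorff_dist (S T) M @[T --> \oo] --> 0%E ->
  (forall e, 0 < e -> \forall T \near \oo, exists2 q, S T q & ball p e q) ->
  M p.
Proof.
move=> clM cvM nearp; apply: clM => B /nbhs_ballP[e /= e0 peB].
have e20 : 0 < e / 2 by rewrite divr_gt0.
have nearM : \forall T \near \oo, (hausdorff_dist (S T) M < (e / 2)%:E)%E.
  have /cvM : nbhs 0%E [set z | (z < (e / 2)%:E)%E].
    by apply: open_nbhs_nbhs; split; [exact: open_ereal_lt_ereal | rewrite /= lte_fin].
  exact.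
have [T [[q Sq pq] hT]] := filter_ex (filterI (nearp _ e20) nearM).
have : (edist_inf M q < (e / 2)%:E)%E.
  apply: le_lt_trans hT; rewrite /hausdorff_dist le_max; apply/orP; left.
  by apply: ereal_sup_ubound; exists q.
move=> /ereal_inf_lt[_ [r Mr <-]] /edist_lt_ball /= qr.
by exists r; split => //; apply: peB; rewrite [e]splitr; apply: ball_triangle pq qr.
Qed.

Lemma simplex_le1 {R : realType} {k : nat} (y : 'rV[R]_k) (i : 'I_k) :
  simplex R k y -> y ord0 i <= 1.
Proof.
by case=> y0 <-; rewrite (bigD1 i) //= lerDl sumr_ge0.
Qed.

(** The mass of y off i is 1 - y_i, and every coordinate other than i is one summand of it. *)
Lemma simplex_dist_vertex {R : realType} {k : nat} (y : 'rV[R]_k) (i j : 'I_k) :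
  simplex R k y -> `|y ord0 j - (j == i)%:R| <= 1 - y ord0 i.
Proof.
move=> Sy; have [y0 y1] := Sy; case: eqVneq => [->|ji].
  by rewrite distrC ger0_norm // subr_ge0 simplex_le1.
rewrite subr0 ger0_norm // lerBrDr -y1 (bigD1 j) //= lerD2l (bigD1 i) 1?eq_sym //=.
by rewrite lerDl sumr_ge0.
Qed.

Section Responses.
Context {R : realType} {m n : nat}.
Variable uL : 'I_m -> 'I_n -> R.

Lemma payoffE (x : 'rV[R]_m) (y : 'rV[R]_n) :
  payoff uL x y = \sum_(j < n) y ord0 j * payoff_pure uL x j.
Proof.
rewrite /payoff /payoff_csp exchange_big; apply: eq_bigr => j _.
by rewrite mulr_sumr; apply: eq_bigr => i _; rewrite mxE; ring.
Qed.

Lemma BR_gap (x : 'rV[R]_m) (j : 'I_n) : BR uL x = [set j] ->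
  exists2 d, 0 < d &
    forall j', j' != j -> payoff_pure uL x j' <= payoff_pure uL x j - d.
Proof.
move=> BRj; have jBR : BR uL x j by rewrite BRj.
(* The seed 1 keeps the minimum positive even when j is the learner's only action. *)
exists (\big[Order.min/1]_(j' | j' != j)
          (payoff_pure uL x j - payoff_pure uL x j')).
  apply: lt_bigmin => // j' j'j; rewrite subr_gt0 lt_neqAle jBR andbT.
  apply: contra j'j => /eqP eqp; apply/eqP.
  by have : BR uL x j' by [move=> k; rewrite eqp; exact: jBR]; rewrite BRj.
move=> j' j'j; rewrite lerBrDr -lerBrDl.
exact: (@bigmin_le_cond _ _ _ _ j' (fun j' => j' != j)).
Qed.

(** Each unit of mass moved off j costs the learner at least d. Writing the bound as a y-average
    over actions makes the comparison termwise. *)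
Lemma payoff_le_gap (x : 'rV[R]_m) (y : 'rV[R]_n) (j : 'I_n) (d : R) :
  (forall j', j' != j -> payoff_pure uL x j' <= payoff_pure uL x j - d) ->
  simplex R n y ->
  payoff uL x y <= payoff_pure uL x j - d * (1 - y ord0 j).
Proof.
move=> gap [y0 y1]; set p := payoff_pure uL x j.
have -> : p - d * (1 - y ord0 j) = \sum_(k < n) y ord0 k * (p - (k != j)%:R * d).
  have -> : 1 - y ord0 j = \sum_(k < n | k != j) y ord0 k.
    by rewrite -y1 (bigD1 j) //= addrAC subrr add0r.
  under [RHS]eq_bigr => k _ do rewrite mulrBr.
  rewrite sumrB -mulr_suml y1 mul1r [X in _ = _ - X](bigD1 j) //= eqxx /=.
  rewrite mul0r mulr0 add0r mulr_sumr; congr (_ - _); apply: eq_bigr => k kj.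
  by rewrite kj /= mul1r mulrC.
rewrite payoffE; apply: ler_sum => k _; apply: ler_wpM2l => //.
by case: eqVneq => [->|kj]; rewrite /= ?mul0r ?subr0 // mul1r gap.
Qed.

(** The regret against j is at least d times the total mass played off j, where d is the payoff gap.
    Hence a regret below d * e * T leaves at most e * T of such mass. *)
Lemma no_regret_constant (A : learning_algorithm R m n) (x : simplex R m)
    (j : 'I_n) (e : R) :
  no_regret uL A -> BR uL (val x) = [set j] -> 0 < e ->
  \forall T \near \oo, forall i k,
    `|average_csp A (fun _ : 'I_T => x) i k - val x ord0 i * (k == j)%:R| <= e.
Proof.
move=> [f [fo regret]] BRj e0; have [d d0 gap] := BR_gap BRj.
have de0 : 0 < d * e by rewrite mulr_gt0.
have := (eqoP _ _ _).1 fo _ de0; apply: filterS2 (nbhs_infty_gt 0) => T T0 fT i k.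
have TR0 : 0 < T%:R :> R by rewrite ltr0n.
set y := fun t => val (response A (fun _ : 'I_T => x) t).
have Sy t : simplex R n (y t) by exact: set_valP.
have [x0 x1] : simplex R m (val x) by exact: set_valP.
have dev : \sum_(t < T) (1 - y t ord0 j) <= T%:R * e.
  rewrite -(ler_pM2l d0).
  have := regret T (fun=> x) j.
  have : \sum_(t < T) payoff uL (val x) (y t) <=
         \sum_(t < T) (payoff_pure uL (val x) j - d * (1 - y t ord0 j)).
    by apply: ler_sum => t _; exact: payoff_le_gap.
  rewrite sumrB -mulr_sumr; move: fT; rewrite /= (ger0_norm (ltW TR0)).
  move=> /(le_trans (ler_norm _)); rewrite /y => *; lra.
rewrite mxE summxE.
(* Since x is constant, x_i factors out, and only the learner's deviation from the vertex j remains
   to be averaged. *)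
have -> : T%:R^-1 * \sum_(t < T) (product_csp (val x) (y t)) i k
    - val x ord0 i * (k == j)%:R
    = T%:R^-1 * (val x ord0 i * \sum_(t < T) (y t ord0 k - (k == j)%:R)).
  rewrite sumrB sumr_const card_ord.
  under eq_bigr => t _ do rewrite mxE.
  rewrite -mulr_sumr -[_ *+ T]mulr_natr.
  by field; rewrite gt_eqF.
rewrite normrM ger0_norm ?invr_ge0 ?ler0n // ler_pdivrMl // normrM ger0_norm //.
apply: (le_trans _ dev).
apply: (@le_trans _ _ (1 * \sum_(t < T) `|y t ord0 k - (k == j)%:R|)).
  by apply: ler_pM => //; [rewrite simplex_le1 | exact: ler_norm_sum].
by rewrite mul1r; apply: ler_sum => t _; exact: simplex_dist_vertex.
Qed.

(** The defining constraints are linear in the profile, so they survive convex combinations. *)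
Lemma no_swap_regret_hull : M_NSR uL `<=` no_swap_regret_csp uL.
Proof.
move=> _ [k [w [s [Ns ->]]]]; have [w0 w1] : simplex R k (val w) by exact: set_valP.
split; first split.
- by move=> i j; rewrite summxE sumr_ge0 // => l _; rewrite mxE mulr_ge0 // (Ns l).1.1.
- under eq_bigr => i _.
    under eq_bigr => j _ do rewrite summxE.
    rewrite exchange_big. over.
  rewrite exchange_big /= -w1; apply: eq_bigr => l _.
  rewrite -[RHS]mulr1 -(Ns l).1.2 mulr_sumr; apply: eq_bigr => i _.
  by rewrite mulr_sumr; apply: eq_bigr => j _; rewrite mxE.
move=> j j'.
have expand q : \sum_i (\sum_l val w ord0 l *: s l) i j * uL i q =
    \sum_l val w ord0 l * \sum_i s l i j * uL i q.
  under eq_bigr => i _ do rewrite summxE mulr_suml.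
  rewrite exchange_big; apply: eq_bigr => l _; rewrite mulr_sumr.
  by apply: eq_bigr => i _; rewrite mxE mulrA.
by rewrite !expand; apply: ler_sum => l _; apply: ler_wpM2l => //; exact: (Ns l).2.
Qed.

Definition learner_marginal (phi : 'M[R]_(m, n)) : 'rV[R]_n :=
  \row_j \sum_(i < m) phi i j.

Lemma learner_marginal_simplex (phi : 'M[R]_(m, n)) :
  csp phi -> simplex R n (learner_marginal phi).
Proof.
move=> [phi0 phi1]; split=> [j|]; first by rewrite mxE sumr_ge0.
by rewrite -phi1 exchange_big; apply: eq_bigr => j _; rewrite mxE.
Qed.

(** The conditional c of phi given j has j as a best response. Mixing in weight e of a strategy x'
    whose only best response is j breaks all ties in favour of j. *)
Lemma strict_conditional (phi : 'M[R]_(m, n)) (e : R) (j : 'I_n) :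
  no_weakly_dominated_action uL -> no_swap_regret_csp uL phi ->
  0 < learner_marginal phi ord0 j -> 0 < e <= 1 ->
  exists2 x : simplex R m, BR uL (val x) = [set j] &
    forall i, `|learner_marginal phi ord0 j * val x ord0 i - phi i j| <= e.
Proof.
move=> hdom [[phi0 phi1] nsr]; set l := learner_marginal phi ord0 j => l0 /andP[e0 e1].
have lE : l = \sum_i phi i j by rewrite /l mxE.
have l_le1 : l <= 1 by apply/simplex_le1/learner_marginal_simplex.
pose c : 'rV[R]_m := \row_i (phi i j / l).
have Sc : simplex R m c.
  split=> [i|]; first by rewrite mxE divr_ge0 // ltW.
  under eq_bigr => i _ do rewrite mxE.
  by rewrite -mulr_suml -lE divff // gt_eqF.
have BRc : BR uL c j.
  move=> j'; rewrite -(ler_pM2l l0) /payoff_pure.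
  have E q : l * (\sum_i c ord0 i * uL i q) = \sum_i phi i j * uL i q.
    rewrite mulr_sumr; apply: eq_bigr => i _; rewrite mxE.
    by field; rewrite gt_eqF.
  by rewrite !E.
have [x' BRx'] := hdom j (ex_intro _ (SigSub (mem_set Sc)) BRc).
have Sx' : simplex R m (val x') by exact: set_valP.
pose z : 'rV[R]_m := (1 - e) *: c + e *: val x'.
have zE i : z ord0 i = (1 - e) * c ord0 i + e * val x' ord0 i by rewrite !mxE.
have Sz : simplex R m z.
  split=> [i|].
    rewrite zE; apply: addr_ge0; apply: mulr_ge0; rewrite ?subr_ge0 ?(ltW e0) //.
      exact: Sc.1.
    exact: Sx'.1.
  under eq_bigr => i _ do rewrite zE.
  by rewrite big_split -!mulr_sumr /= Sx'.2 Sc.2 !mulr1 subrK.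
have payz q : payoff_pure uL z q =
    (1 - e) * payoff_pure uL c q + e * payoff_pure uL (val x') q.
  rewrite !mulr_sumr -big_split; apply: eq_bigr => i _.
  by rewrite zE mulrDl !mulrA.
exists (SigSub (mem_set Sz)); last first.
  move=> i /=.
  (* As l * c_i = phi_ij, only the mixing term is left; both of its entries lie in [0, 1]. *)
  have -> : l * z ord0 i - phi i j = e * (l * val x' ord0 i - phi i j).
    by rewrite !mxE; field; rewrite gt_eqF.
  rewrite normrM gtr0_norm // ler_piMr ?(ltW e0) // ler_norml.
  have phi_le1 : phi i j <= l by rewrite lE (bigD1 i) //= lerDl sumr_ge0.
  have x'0 := Sx'.1 i; have x'1 := simplex_le1 i Sx'; have p0 := phi0 i j.
  have : 0 <= l * val x' ord0 i <= 1.
    rewrite mulr_ge0 ?(ltW l0) //=; apply: mulr_ile1 => //; exact: ltW.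
  by move=> /andP[? ?]; apply/andP; split; lra.
have BRx'j : BR uL (val x') j by rewrite BRx'.
rewrite eqEsubset; split => [q BRq /=|_ -> q] /=; last first.
  by rewrite !payz lerD // ler_wpM2l ?subr_ge0 // ltW.
(* Against c, q does no better than j; against x' it does strictly worse, or else q would also be a
   best response to x'. *)
apply/eqP; apply: contrapT => qj; have := BRq j; rewrite /= !payz leNgt => /negP; apply.
apply: ler_ltD; first by rewrite ler_wpM2l ?subr_ge0.
rewrite ltr_pM2l // ltNge; apply/negP => jq; apply: qj; apply/eqP.
suff : BR uL (val x') q by rewrite BRx'.
by move=> r; apply: le_trans jq; exact: BRx'j.
Qed.

End Responses.

Theorem lemma3p8 (R : realType) (m n : nat) (uL : 'I_m -> 'I_n -> R)
    (huL : forall i j, -1 <= uL i j <= 1)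
    (hmax : unique_maximizer uL)
    (hdom : no_weakly_dominated_action uL)
    (A : learning_algorithm R m n)
    (hcons : consistent A)
    (hnr : no_regret uL A) :
  M_NSR uL `<=` asymptotic_menu A.
Proof.
move=> phi /no_swap_regret_hull Nphi; have [Cphi _] := Nphi.
have [clM cvM] : is_asymptotic_menu A (asymptotic_menu A) := xgetPex _ hcons.
apply: (closed_hausdorff_lim clM cvM) => e e0.
pose l := learner_marginal phi.
have Sl : simplex R n l by exact: learner_marginal_simplex.
have [l0 l1] := Sl.
(* The cap 1 lets d serve as a mixing weight. Two errors of at most e / 3 then sum to strictly less
   than e. *)
pose d := Order.min 1 (e / 3).
have d01 : 0 < d <= 1 by rewrite lt_min ltr01 divr_gt0 //= ge_min lexx.
have de : d <= e / 3 by rewrite ge_min lexx orbT.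
have pick j : exists x : simplex R m, 0 < l ord0 j ->
    BR uL (val x) = [set j] /\
    forall i, `|l ord0 j * val x ord0 i - phi i j| <= d.
  have [lj|lj] := ltP 0 (l ord0 j).
    have [x BRx xphi] := strict_conditional hdom Nphi lj d01.
    by exists x.
  (* For an action of weight zero any strategy will do: the row of the maximizing pair gives a
     vertex of the simplex. *)
  have [[i _] _] := hmax.
  have Si : simplex R m (delta_mx ord0 i).
    split=> [k|]; first by rewrite mxE ler0n.
    rewrite (bigD1 i) //= mxE !eqxx big1 ?addr0 // => k ki.
    by rewrite mxE (negbTE ki) andbF.
  by exists (SigSub (mem_set Si)).
have [x xP] := choice pick.
pose a T j := average_csp A (fun _ : 'I_T => x j).
have : \forall T \near \oo, forall j, 0 < l ord0 j -> forall i k,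
    `|a T j i k - val (x j) ord0 i * (k == j)%:R| <= d.
  (* There are finitely many actions, so one threshold on T works for all of them. *)
  apply: filter_forall => j; have [lj|lj] := ltP 0 (l ord0 j).
    have [BRj _] := xP j lj; have [d0 _] := andP d01.
    have := no_regret_constant hnr BRj d0.
    by apply: filterS => T aT _.
  by apply: nearW => T.
apply: filterS => T aT.
exists (\sum_j l ord0 j *: a T j).
  exists n, (SigSub (mem_set Sl)), (a T); split=> [j|//].
  by exists (fun=> x j).
split=> // i k; rewrite /ball /= summxE.
have near_target : `|l ord0 k * val (x k) ord0 i - phi i k| <= d.
  have [lk|] := ltP 0 (l ord0 k); first exact: (xP k lk).2.
  rewrite le_eqVlt ltNge l0 orbF => /eqP lk.
  (* When the marginal at k is zero, the whole column k of phi vanishes. *)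
  have : phi i k <= l ord0 k.
    by rewrite mxE (bigD1 i) //= lerDl sumr_ge0 // => ? _; exact: Cphi.1.
  rewrite lk => phile; have -> : phi i k = 0 by apply/le_anti; rewrite phile Cphi.1.
  by rewrite mul0r subrr normr0 ltW //; case/andP: d01.
have near_average :
    `|\sum_j (l ord0 j *: a T j) i k - l ord0 k * val (x k) ord0 i| <= d.
  (* Only action k contributes to column k of the target, so both sides become sums over j with
     weights l_j. These weights sum to 1, which keeps the averaged error below d. *)
  have -> : l ord0 k * val (x k) ord0 i =
      \sum_j l ord0 j * (val (x j) ord0 i * (k == j)%:R).
    rewrite (bigD1 k) //= eqxx mulr1 big1 ?addr0 // => j jk.
    by rewrite eq_sym (negbTE jk) !mulr0.
  rewrite -sumrB; apply: le_trans (ler_norm_sum _ _ _) _.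
  have -> : d = \sum_j l ord0 j * d by rewrite -mulr_suml l1 mul1r.
  apply: ler_sum => j _.
  rewrite mxE -mulrBr normrM (ger0_norm (l0 j)).
  have [lj|lj] := ltP 0 (l ord0 j); first by apply: ler_wpM2l => //; exact: aT.
  by have -> : l ord0 j = 0 by [apply/le_anti; rewrite lj l0]; rewrite !mul0r.
rewrite distrC; set s := \sum_j _.
have -> : s - phi i k = (s - l ord0 k * val (x k) ord0 i)
  + (l ord0 k * val (x k) ord0 i - phi i k) by ring.
apply: le_lt_trans (ler_normD _ _) _; lra.
Qed.
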